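(* Let $X$ be an operator space and let $v \in \mathrm{Ball}(X)$. Then $(X,v)$ is a unital operator space if and only if there is $\delta > 0$ such that for all $n \in \mathbb{N}$ and all $x \in M_n(X)$ with $\Vert x\Vert_n < \delta$, $$\left\Vert \begin{bmatrix} v_n & x \\ 0 & v_n \end{bmatrix} \right\Vert \geq \sqrt{1 + \Vert x \Vert_n}.$$
   Context: All vector spaces are over $\mathbb{C}$ and operator spaces are complete. An operator space $X$ carries its matrix norms $\Vert\cdot\Vert_n$ on $M_n(X)$; the displayed $2\times 2$ block matrix is regarded as an element of $M_{2n}(X)$. $\mathrm{Ball}(X)$ is the closed unit ball of $X$. For $v \in X$, $v_n = v \otimes I_n \in M_n(X)$ is the diagonal matrix with $v$ in each diagonal entry. A pair $(X,v)$, with $X$ an operator space and $v \in X$, is a unital operator space if there exist a Hilbert space $H$ and a linear complete isometry $T : X \to B(H)$ with $T(v) = I_H$. *)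

(* Defs.v *)
From HB Require Import structures.
From mathcomp Require Import all_boot all_order all_algebra.
From mathcomp Require Import complex.
From mathcomp Require Import all_classical all_reals all_analysis.

Set Implicit Arguments.
Unset Strict Implicit.
Unset Printing Implicit Defensive.

Import Order.TTheory GRing.Theory Num.Theory.
Import numFieldNormedType.Exports.

Local Open Scope classical_set_scope.
Local Open Scope ring_scope.
Local Open Scope complex_scope.

Record hilbertSpace (R : realType) := HilbertSpace {
  hilbert_sort :> completeNormedModType R[i];
  inner : {dot hilbert_sort for Num.conj};
  innerE : forall h : hilbert_sort, inner h h = `|h| ^+ 2
}.

Section BoundedOperators.
Variables (R : realType) (H : hilbertSpace R).

Definition bounded_op (f : {linear H -> H}) : Prop :=
  exists k : R, forall h : H, `|f h| <= k%:C * `|h|.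

(* The norm of the Hilbert space direct sum H^n; `|h| lies in R[i], and it is
   its own real part. *)
Definition l2norm n (h : 'cV[H]_n) : R :=
  Num.sqrt (\sum_i complex.Re `|h i 0| ^+ 2).

Definition opmx_apply n (A : 'M[{linear H -> H}]_n) (h : 'cV[H]_n) : 'cV[H]_n :=
  \col_i \sum_j A i j (h j 0).

(* The norm of M_n(B(H)) = B(H^n), meaningful for bounded entries only. *)
Definition opmx_norm n (A : 'M[{linear H -> H}]_n) : R :=
  sup [set l2norm (opmx_apply A h) | h in [set h | l2norm h <= 1]].

End BoundedOperators.

(* A linear complete isometry X -> B(H), for matrix norms on X.  The index
   n = 0 is excluded here and below: M_n(X) is only considered for n >= 1. *)
Definition complete_isometry (R : realType) (X : lmodType R[i])
    (mn : forall n, 'M[X]_n -> R) (H : hilbertSpace R)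
    (T : X -> {linear H -> H}) : Prop :=
  [/\ linear (fun x => T x : H -> H),
      forall x, bounded_op (T x) &
      forall n (x : 'M[X]_n), (0 < n)%N -> opmx_norm (map_mx T x) = mn n x].

(* A complete operator space in the sense of Blecher and Le Merdy: a vector
   space with norms on all M_n(X) that are induced by a linear complete isometry
   into some B(K). *)
Record operatorSpace (R : realType) := OperatorSpace {
  opspace_sort :> completeNormedModType R[i];
  mnorm : forall n, 'M[opspace_sort]_n -> R;
  mnorm1E : forall x : opspace_sort, `|x| = (mnorm (x%:M : 'M[opspace_sort]_1))%:C;
  mnorm_repr : exists (K : hilbertSpace R) (T : opspace_sort -> {linear K -> K}),
    complete_isometry mnorm T
}.

Arguments mnorm {R o n} _.

(* H is required to be nonzero, so that I_H has norm 1: otherwise the zero space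
   with v = 0 would count as unital. *)
Definition unital_operator_space (R : realType) (X : operatorSpace R) (v : X)
    : Prop :=
  exists (H : hilbertSpace R) (T : X -> {linear H -> H}),
    [/\ exists h : H, h != 0, complete_isometry (@mnorm R X) T &
        forall h : H, T v h = h].

(* Main.v *)
Require Import Defs.
From HB Require Import structures.
From mathcomp Require Import all_boot all_order all_algebra.
From mathcomp Require Import complex ring lra.
From mathcomp Require Import all_classical all_reals all_analysis.

Import Order.TTheory GRing.Theory Num.Theory.
Import numFieldNormedType.Exports.

(** If v is the identity of H, let b be a vector of norm at most 1 with |x b| = s
close to |x|.  The block operator multiplies the squared norm of the vector with
components x b / s and b by at least 1 + s (unital_block_norm); letting s tend to
|x| yields the inequality, for x of any size.

Conversely, realise X on a Hilbert space K, so that v becomes a contraction.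
Apply the inequality to t x with |x| = 1 and t tending to 0: there are xi and
eta with |xi|^2 + |eta|^2 <= 1 and

   |v xi + t x eta|^2 + |v eta|^2  >=  1 + t - t^2.

Expanding the square shows that v is isometric on xi and on eta up to O(t^2),
whereas 2 Re <t x eta, v xi> >= t - O(t^2): the first-order term t can only come
from this cross term (near_extremal).  In an ultrapower of K the approximate
statements become exact.  Let E be the space of classes of bounded
sequences on which v is isometric in the limit, that is, the kernel of 1 - v* v
in the ultrapower.  The compression phi(x) = (v|_E)* x |_E is a complete
contraction from X to B(E) sending v to the identity of E, because v is
isometric on E.  It is completely isometric, because the vectors xi and eta
found above have their entries in E and satisfy Re <phi(x) eta, xi> >= 1/2 while
|xi|^2 + |eta|^2 <= 1.

The analytic input is therefore: the Riesz representation theorem, from which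
phi(x) is obtained (riesz, operator_of_form), the completeness of the ultrapower
(ultra_complete), and the passage from a complete semi-inner product to a
Hilbert space (hilbert_of_semi_inner). *)

Set Implicit Arguments.
Unset Strict Implicit.
Unset Printing Implicit Defensive.

Local Open Scope classical_set_scope.
Local Open Scope ring_scope.
Local Open Scope complex_scope.

(** * Semi-inner products on complex vector spaces *)

Lemma inv_nat_lt (R : realType) (e : R) : 0 < e -> exists m, m.+1%:R^-1 < e.
Proof.
move=> e0; exists (Num.trunc e^-1).
by rewrite invf_plt ?posrE// truncnS_gt.
Qed.

(** The real part of a positive semi-definite sesquilinear form.  It determines
the form (see cform below), and only real-valued limits have to be taken when
such forms are passed to an ultraproduct. *)
Record semi_inner (R : realType) (V : lmodType R[i]) := SemiInner {
  rform :> V -> V -> R;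
  rformDl : forall a b c, rform (a + b) c = rform a c + rform b c;
  rformZl : forall (t : R) a b, rform (t%:C *: a) b = t * rform a b;
  rformI : forall a b, rform ('i%C *: a) ('i%C *: b) = rform a b;
  rformC : forall a b, rform a b = rform b a;
  rform_ge0 : forall a, 0 <= rform a a }.

Section SemiInnerTheory.
Variables (R : realType) (V : lmodType R[i]) (r : semi_inner V).
Implicit Types a b c : V.

Lemma rformDr a b c : r a (b + c) = r a b + r a c.
Proof. by rewrite rformC rformDl (rformC r b) (rformC r c). Qed.

Lemma rformZr (t : R) a b : r a (t%:C *: b) = t * r a b.
Proof. by rewrite rformC rformZl rformC. Qed.

Lemma rformNl a b : r (- a) b = - r a b.
Proof. by rewrite -scaleN1r -(rmorphN1 (real_complex R)) rformZl mulN1r. Qed.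

Lemma rformNr a b : r a (- b) = - r a b.
Proof. by rewrite rformC rformNl rformC. Qed.

Lemma rform0l b : r 0 b = 0.
Proof. by rewrite -(scale0r 0) -(rmorph0 (real_complex R)) rformZl mul0r. Qed.

Lemma rform_suml I (s : seq I) P (F : I -> V) b :
  r (\sum_(i <- s | P i) F i) b = \sum_(i <- s | P i) r (F i) b.
Proof.
by apply: (big_morph (fun a => r a b)) => [x y|]; rewrite ?rformDl ?rform0l.
Qed.

Definition expand_rform :=
  (rformDl, rformDr, rformNl, rformNr, rformZl, rformZr).

Lemma i_scale_i a : 'i%C *: ('i%C *: a) = - a :> V.
Proof. by rewrite scalerA -expr2 sqr_i scaleN1r. Qed.

(** Multiplication by i is skew-adjoint for the real part. *)
Lemma rformIr a b : r ('i%C *: a) b = - r a ('i%C *: b).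
Proof. by rewrite -(rformI r a) i_scale_i rformNr opprK. Qed.

Lemma rform_i a : r a ('i%C *: a) = 0.
Proof. by have := rformIr a a; rewrite rformC; lra. Qed.

Lemma complex_scaleE (z : R[i]) a :
  z *: a = (complex.Re z)%:C *: a + (complex.Im z)%:C *: ('i%C *: a).
Proof. by rewrite scalerA -scalerDl [in LHS](complexE z) (mulrC 'i%C). Qed.

Definition snorm a : R := Num.sqrt (r a a).

Lemma snorm_ge0 a : 0 <= snorm a. Proof. exact: sqrtr_ge0. Qed.

Lemma snorm2 a : snorm a ^+ 2 = r a a.
Proof. by rewrite sqr_sqrtr// rform_ge0. Qed.

Lemma snorm0 : snorm 0 = 0. Proof. by rewrite /snorm rform0l sqrtr0. Qed.

Lemma rform_quad (s t : R) a b :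
  r (s%:C *: a - t%:C *: b) (s%:C *: a - t%:C *: b) =
  s ^+ 2 * r a a - 2 * s * t * r a b + t ^+ 2 * r b b.
Proof. by rewrite !expand_rform (rformC r b a); ring. Qed.

(** The quadratic form is nonnegative at r(b,b) a - r(a,b) b, which settles the
case of nonzero r(b,b); if r(b,b) = 0, the form is affine along the line a - t b
and would take the value -1 if r(a,b) were nonzero. *)
Lemma cauchy_schwarz2 a b : r a b ^+ 2 <= r a a * r b b.
Proof.
have quad s t : 0 <= s ^+ 2 * r a a - 2 * s * t * r a b + t ^+ 2 * r b b.
  by rewrite -rform_quad rform_ge0.
have [B0|B0] := eqVneq (r b b) 0.
  rewrite B0 mulr0; have [->|rn0] := eqVneq (r a b) 0; first by rewrite expr0n.
  have := quad 1 ((r a a + 1) / (2 * r a b)); rewrite B0.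
  have -> : 1 ^+ 2 * r a a - 2 * 1 * ((r a a + 1) / (2 * r a b)) * r a b +
    ((r a a + 1) / (2 * r a b)) ^+ 2 * 0 = -1 by field.
  by lra.
have Bgt0 : 0 < r b b by rewrite lt_def B0 rform_ge0.
have := quad (r b b) (r a b); rewrite -subr_ge0.
have -> : r b b ^+ 2 * r a a - 2 * r b b * r a b * r a b + r a b ^+ 2 * r b b - 0
   = r b b * (r a a * r b b - r a b ^+ 2) by ring.
by rewrite pmulr_rge0 // subr_ge0.
Qed.

Lemma cauchy_schwarz_abs a b : `|r a b| <= snorm a * snorm b.
Proof.
rewrite -ler_sqr ?nnegrE ?mulr_ge0 ?snorm_ge0//.
by rewrite exprMn !snorm2 -normrX ger0_norm ?sqr_ge0 ?cauchy_schwarz2.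
Qed.

Lemma cauchy_schwarz a b : r a b <= snorm a * snorm b.
Proof. exact: le_trans (ler_norm _) (cauchy_schwarz_abs _ _). Qed.

Lemma snormD a b : snorm (a + b) <= snorm a + snorm b.
Proof.
rewrite -ler_sqr ?nnegrE ?addr_ge0 ?snorm_ge0//.
rewrite sqrrD !snorm2 !expand_rform (rformC r b a).
by have := cauchy_schwarz a b; lra.
Qed.

Lemma rformZZ (z : R[i]) a :
  r (z *: a) (z *: a) = (complex.Re z ^+ 2 + complex.Im z ^+ 2) * r a a.
Proof.
rewrite complex_scaleE !expand_rform rformI rformC.
by rewrite (rformC r ('i%C *: a)) rform_i; ring.
Qed.

Lemma snormZ (z : R[i]) a : (snorm (z *: a))%:C = `|z| * (snorm a)%:C.
Proof.
rewrite normc_def -rmorphM /= /snorm rformZZ.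
by rewrite sqrtrM // addr_ge0 // sqr_ge0.
Qed.

Lemma snormZr (t : R) a : snorm (t%:C *: a) = `|t| * snorm a.
Proof.
apply: (@complexI R); rewrite snormZ rmorphM; congr (_ * _).
by rewrite normc_def /= expr0n addr0 sqrtr_sqr.
Qed.

Lemma snormN a : snorm (- a) = snorm a.
Proof. by rewrite /snorm rformNl rformNr opprK. Qed.

Lemma snorm_sub a b : snorm (a - b) = snorm (b - a).
Proof. by rewrite -opprB snormN. Qed.

Lemma snormB_tri a b : snorm a - snorm b <= snorm (a - b).
Proof. by rewrite lerBlDr -[in leLHS](subrK b a) snormD. Qed.

(** The complex form with real part r: linear on the left, conjugate-linear on
the right, so its imaginary part at (a,b) is the real part at (a, i b). *)
Definition cform a b : R[i] := r a b +i* r a ('i%C *: b).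

Lemma cformDl a b c : cform (a + b) c = cform a c + cform b c.
Proof. by rewrite /cform !rformDl. Qed.

Lemma cformZl (z : R[i]) a b : cform (z *: a) b = z * cform a b.
Proof.
rewrite /cform (complex_scaleE z a) !rformDl !rformZl rformI.
rewrite (rformIr a b); case: z => x y /=.
by apply/eqP; rewrite eq_complex /=; apply/andP; split; apply/eqP; ring.
Qed.

Lemma cformC a b : cform a b = (cform b a)^*.
Proof.
rewrite /cform /=; apply/eqP; rewrite eq_complex /= rformC eqxx /=.
by rewrite (rformC r a) rformIr.
Qed.

Lemma cform_diag a : cform a a = (r a a)%:C.
Proof. by rewrite /cform rform_i. Qed.

Lemma cformBl a b c : cform (a - b) c = cform a c - cform b c.
Proof. by rewrite cformDl -scaleN1r cformZl mulN1r. Qed.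

Lemma cform_eq a b : (cform a = cform b) <-> snorm (a - b) = 0.
Proof.
split=> [e|s0].
  have : cform (a - b) (a - b) = 0 by rewrite cformBl e subrr.
  by rewrite cform_diag => -[h]; rewrite /snorm h sqrtr0.
have r0 c : r (a - b) c = 0.
  have := cauchy_schwarz_abs (a - b) c; rewrite s0 mul0r normr_le0.
  by move/eqP.
apply/funext => c; apply/eqP; rewrite -subr_eq0 -cformBl /cform !r0.
exact: eqxx.
Qed.

End SemiInnerTheory.

(** * The Hilbert space of a complete semi-inner product *)

(** Completeness tested on the sequences that converge at the rate 1 / (m + 1);
every Cauchy filter contains balls around the terms of such a sequence. *)
Definition seq_complete (R : realType) (V : lmodType R[i]) (r : semi_inner V) :=
  forall a : nat -> V,
    (forall m k, snorm r (a m - a k) <= m.+1%:R^-1 + k.+1%:R^-1) ->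
    exists b, forall m, snorm r (a m - b) <= 2 * m.+1%:R^-1.

Section Separation.
Variables (R : realType) (V : lmodType R[i]) (r : semi_inner V).

(** The separated quotient of V is realised inside the space of functions on V,
an element a being sent to the functional that it represents: two elements with
the same image are at distance zero (cform_eq), and the linear structure is that
of functions. *)
Definition is_cform : pred (V -> R[i]) := fun f => `[< exists a, f = cform r a >].

(** The completeness proof is a parameter of the type so that the structure of
complete normed module can be attached to it. *)
Record separated (rc : seq_complete r) := Separated {
  sep_fun :> V -> R[i];
  sep_funP : is_cform sep_fun }.

Lemma is_cform_submod : submod_closed is_cform.
Proof.
split=> [|z f g /asboolP[a ->] /asboolP[b ->]]; apply/asboolP.
  by exists 0; apply/funext => c; rewrite -[X in cform r X](scale0r 0) cformZl mul0r.
by exists (z *: a + b); apply/funext => c; rewrite cformDl cformZl.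
Qed.
HB.instance Definition _ :=
  GRing.isSubmodClosed.Build R[i] (V -> R[i]) is_cform is_cform_submod.

Variable rc : seq_complete r.
HB.instance Definition _ := [isSub of separated rc for @sep_fun rc].
HB.instance Definition _ := [Choice of separated rc by <:].
HB.instance Definition _ := [SubChoice_isSubLmodule of separated rc by <:].

Definition proj (a : V) : separated rc :=
  @Separated rc (cform r a) (asboolT (ex_intro _ a erefl)).

Lemma proj_surj (f : separated rc) : exists a, f = proj a.
Proof.
by have /asboolP[a fa] := sep_funP f; exists a; apply: val_inj.
Qed.

Lemma proj_linear : linear proj.
Proof.
move=> z a b; apply: val_inj.
have -> : val (z *: proj a + proj b) = z *: (cform r a) + cform r b by [].
by apply/funext => c; rewrite /= cformDl cformZl.
Qed.

Lemma proj_eq a b : (proj a = proj b) <-> snorm r (a - b) = 0.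
Proof.
rewrite -cform_eq; split=> [/(congr1 val) //|e]; exact: val_inj.
Qed.

Definition repr_of (f : separated rc) : V := sval (cid (proj_surj f)).

Lemma repr_ofK f : proj (repr_of f) = f.
Proof. by rewrite /repr_of; case: cid => a /=. Qed.

Definition sep_norm (f : separated rc) : R[i] := (snorm r (repr_of f))%:C.

Lemma sep_norm_proj a : sep_norm (proj a) = (snorm r a)%:C.
Proof.
have /proj_eq e := repr_ofK (proj a); rewrite /sep_norm; congr (_%:C).
apply/eqP; rewrite eq_le; apply/andP; split; rewrite -subr_le0 -e.
  exact: snormB_tri.
by rewrite snorm_sub snormB_tri.
Qed.

Lemma sep_normD f g : sep_norm (f + g) <= sep_norm f + sep_norm g.
Proof.
have [a ->] := proj_surj f; have [b ->] := proj_surj g.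
have -> : proj a + proj b = proj (a + b).
  by have := proj_linear 1 a b; rewrite !scale1r.
by rewrite !sep_norm_proj -rmorphD lecR snormD.
Qed.

Lemma sep_normZ (z : R[i]) f : sep_norm (z *: f) = `|z| * sep_norm f.
Proof.
have p0 : proj 0 = 0.
  by have := proj_linear (-1) 0 0; rewrite !scaleN1r !addNr.
have [a ->] := proj_surj f; have -> : z *: proj a = proj (z *: a).
  by have := proj_linear z a 0; rewrite p0 !addr0.
by rewrite !sep_norm_proj snormZ.
Qed.

Lemma sep_norm0_eq0 f : sep_norm f = 0 -> f = 0.
Proof.
have [a ->] := proj_surj f; rewrite sep_norm_proj => -[a0].
have <- : proj 0 = 0.
  by have := proj_linear (-1) 0 0; rewrite !scaleN1r !addNr.
by apply/proj_eq; rewrite subr0.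
Qed.

HB.instance Definition _ :=
  Lmodule_isNormed.Build R[i] (separated rc) sep_normD sep_normZ sep_norm0_eq0.

Lemma normE_proj a : `|proj a| = (snorm r a)%:C.
Proof. exact: sep_norm_proj. Qed.

Lemma projB a b : proj (a - b) = proj a - proj b.
Proof.
by have := proj_linear (-1) b a; rewrite !scaleN1r ![- _ + _]addrC.
Qed.

Lemma sep_complete (F : set_system (separated rc)) :
  ProperFilter F -> cauchy F -> cvg F.
Proof.
move=> FF cF.
have key m : exists a, F (ball (proj a) (m.+1%:R^-1 : R[i])).
  have m0 : (0 : R[i]) < m.+1%:R^-1 by rewrite invr_gt0 ltr0n.
  have [f Ff] := (cauchyP F).1 cF _ m0.
  by have [a fa] := proj_surj f; exists a; rewrite -fa.
pose a m := sval (cid (key m)).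
have aP m : F (ball (proj (a m)) (m.+1%:R^-1 : R[i])).
  by rewrite /a; case: cid.
have natC m : (m.+1%:R^-1 : R[i]) = (m.+1%:R^-1)%:C by rewrite fmorphV rmorph_nat.
have [b ab] : exists b, forall m, snorm r (a m - b) <= 2 * m.+1%:R^-1.
  apply: rc => m k; have [g [/= bm bk]] := filter_ex (filterI (aP m) (aP k)).
  rewrite -lecR -normE_proj projB.
  have -> : (m.+1%:R^-1 + k.+1%:R^-1)%:C = m.+1%:R^-1 + k.+1%:R^-1 :> R[i].
    by rewrite !natC -rmorphD.
  apply: ltW.
  rewrite -ball_normE /= in bm bk.
  rewrite -(subrK g (proj (a m))) -addrA; apply: le_lt_trans (ler_normD _ _) _.
  by rewrite ltrD // distrC.
apply/cvg_ex; exists (proj b); apply/cvg_ballP => e e0.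
have [e' ee] : exists e', e = e'%:C.
  by exists (complex.Re e); rewrite RRe_real // ger0_real // ltW.
rewrite {e}ee ltcR in e0 *.
have [m hm] : exists m, m.+1%:R^-1 < e' / 3 by apply: inv_nat_lt; lra.
apply: filterS (aP m) => g; rewrite -!ball_normE /= => gm.
rewrite -(subrK (proj (a m)) (proj b)) -addrA.
apply: le_lt_trans (ler_normD _ _) _.
rewrite distrC -projB normE_proj.
apply: (@lt_le_trans _ _ ((2 * m.+1%:R^-1)%:C + (m.+1%:R^-1)%:C)).
  by rewrite ler_ltD ?lecR// -natC.
rewrite -rmorphD lecR; move: hm; set t := _^-1; lra.
Qed.

HB.instance Definition _ :=
  Uniform_isComplete.Build (separated rc) sep_complete.

Definition sep_inner (f g : separated rc) : R[i] := f (repr_of g).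

Lemma sep_inner_proj a b : sep_inner (proj a) (proj b) = cform r a b.
Proof.
rewrite /sep_inner /= cformC [RHS]cformC; congr (_^*).
suff -> : cform r (repr_of (proj b)) = cform r b by [].
by apply/cform_eq/proj_eq; rewrite repr_ofK.
Qed.

Lemma sep_innerC f g : sep_inner f g = (sep_inner g f)^*.
Proof.
have [a ->] := proj_surj f; have [b ->] := proj_surj g.
by rewrite !sep_inner_proj cformC.
Qed.

Lemma sep_inner_linear g (z : R[i]) f h :
  sep_inner (z *: f + h) g = z * sep_inner f g + sep_inner h g.
Proof.
have [a ->] := proj_surj f; have [b ->] := proj_surj g.
have [c ->] := proj_surj h.
by rewrite -proj_linear !sep_inner_proj cformDl cformZl.
Qed.

Lemma sep_inner_bilinear :
  bilinear_for ( *%R : R[i] -> R[i] -> R[i]) (Num.conj \; *%R) sep_inner.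
Proof.
split=> [g z f h|f z g h]; rewrite ?sep_inner_linear//.
by rewrite sep_innerC sep_inner_linear !rmorphD rmorphM /= -!sep_innerC.
Qed.

HB.instance Definition _ :=
  bilinear_isBilinear.Build R[i] (separated rc) (separated rc) R[i] *%R
    (Num.conj \; *%R) sep_inner sep_inner_bilinear.

HB.instance Definition _ :=
  isHermitianSesquilinear.Build R[i] (separated rc) false Num.conj sep_inner
    (fun f g => etrans (sep_innerC f g) (esym (mul1r _))).

Lemma sep_inner_norm f : sep_inner f f = `|f| ^+ 2.
Proof.
have [a ->] := proj_surj f.
by rewrite sep_inner_proj cform_diag normE_proj -rmorphXn snorm2.
Qed.

Lemma sep_inner_gt0 f : f != 0 -> 0 < sep_inner f f.
Proof. by move=> f0; rewrite sep_inner_norm exprn_gt0// normr_gt0. Qed.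

HB.instance Definition _ :=
  isDotProduct.Build R[i] (separated rc) sep_inner sep_inner_gt0.

Definition sep_hilbert : hilbertSpace R := HilbertSpace sep_inner_norm.

End Separation.

(** As V is already complete, the separated quotient needs no completion, so the
quotient map p is onto. *)
Lemma hilbert_of_semi_inner (R : realType) (V : lmodType R[i])
    (r : semi_inner V) : seq_complete r ->
  exists (H : hilbertSpace R) (p : V -> H),
    [/\ linear p, forall h, exists a, h = p a &
        forall a b, inner H (p a) (p b) = cform r a b].
Proof.
move=> rc; exists (sep_hilbert rc), (@proj R V r rc).
split; [exact: proj_linear|exact: proj_surj|exact: sep_inner_proj].
Qed.

(** * The Riesz representation theorem *)

Section Riesz.
Variables (R : realType) (V : lmodType R[i]) (r : semi_inner V).
Variables (f : V -> R) (C : R).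
Hypothesis fD : forall a b, f (a + b) = f a + f b.
Hypothesis fZ : forall (t : R) a, f (t%:C *: a) = t * f a.
Hypothesis f_bounded : forall a, `|f a| <= C * snorm r a.

(* The vector representing f minimises J, and a minimising sequence is Cauchy by
   the parallelogram law (J_midpoint). *)
Let J a := r a a - 2 * f a.

Let J_ge a : - C ^+ 2 <= J a.
Proof.
rewrite /J -snorm2; have := f_bounded a; have := ler_norm (f a).
by have := sqr_ge0 (snorm r a - C); rewrite sqrrB; lra.
Qed.

Let mJ := inf (range J).

Let has_infJ : has_inf (range J).
Proof.
split; first by exists (J 0), 0.
by exists (- C ^+ 2) => _ [a _ <-]; exact: J_ge.
Qed.

Let mJ_le a : mJ <= J a.
Proof. by apply: ge_inf; [exact: (has_infJ).2|exists a]. Qed.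

Let minimizing m : exists a, J a <= mJ + m.+1%:R^-1 ^+ 2 / 2.
Proof.
have e0 : 0 < (m.+1%:R^-1 : R) ^+ 2 / 2.
  by rewrite divr_gt0// exprn_gt0// invr_gt0.
have [_ [a _ <-] aJ] := inf_adherent e0 has_infJ.
by exists a; apply: ltW.
Qed.

Let J_midpoint a b : r (a - b) (a - b) / 2 = J a + J b - 2 * J (2^-1%:C *: (a + b)).
Proof. by rewrite /J !expand_rform fZ fD (rformC r b a); field. Qed.

(* Approximate Euler-Lagrange equation at an approximate minimiser, obtained by
   minimising J along the line through a in the direction h. *)
Let J_near a e : J a <= mJ + e ^+ 2 -> forall h, (r a h - f h) ^+ 2 <= e ^+ 2 * r h h.
Proof.
move=> ae h; set D := r a h - f h.
have quad t : - e ^+ 2 <= 2 * t * D + t ^+ 2 * r h h.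
  have := mJ_le (a + t%:C *: h); move: ae; rewrite /J !expand_rform fD fZ.
  by rewrite (rformC r h a) /D; lra.
have [h0|h0] := eqVneq (r h h) 0.
  have sh0 : snorm r h = 0 by rewrite /snorm h0 sqrtr0.
  have := f_bounded h; have := cauchy_schwarz_abs r a h.
  rewrite sh0 !mulr0 !normr_le0 /D => /eqP-> /eqP->.
  by rewrite subr0 expr0n h0 mulr0.
have hgt : 0 < r h h by rewrite lt_def h0 rform_ge0.
have := quad (- D / r h h).
have -> : 2 * (- D / r h h) * D + (- D / r h h) ^+ 2 * r h h = - (D ^+ 2 / r h h).
  by field.
by rewrite lerN2 ler_pdivrMr.
Qed.

(** The limit of a minimising sequence represents f: J is not evaluated at the
limit, the approximate Euler-Lagrange equations are passed to it instead. *)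
Lemma riesz : seq_complete r -> exists z, forall h, f h = r z h.
Proof.
move=> rc; have [a aJ] := choice minimizing.
have [m k|z az] := rc a.
  have em n : 0 <= (n.+1%:R^-1 : R) by rewrite invr_ge0.
  rewrite -ler_sqr ?nnegrE ?snorm_ge0 ?addr_ge0// snorm2 sqrrD.
  have := J_midpoint (a m) (a k); have := mJ_le (2^-1%:C *: (a m + a k)).
  have := aJ m; have := aJ k; have := mulr_ge0 (em m) (em k).
  move: (m.+1%:R^-1 : R) (k.+1%:R^-1 : R) => s t.
  lra.
exists z => h; apply/eqP; rewrite eq_sym -subr_eq0 -normr_le0 leNgt; apply/negP => d0.
have [m] : exists m, m.+1%:R^-1 < `|r z h - f h| / (3 * (snorm r h + 1)).
  by apply: inv_nat_lt; rewrite divr_gt0// mulr_gt0// ltr_wpDl// snorm_ge0.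
set e : R := m.+1%:R^-1 => em; have e0 : 0 < e by rewrite invr_gt0.
have s0 := snorm_ge0 r h.
move: em; rewrite ltr_pdivlMr ?mulr_gt0 ?ltr_wpDl//; apply/negP; rewrite -leNgt.
have h1 : `|r (a m) h - f h| <= e * snorm r h.
  rewrite -ler_sqr ?nnegrE ?mulr_ge0 ?(ltW e0)// -normrX ger0_norm ?sqr_ge0//.
  rewrite exprMn snorm2; apply: J_near; apply: le_trans (aJ m) _.
  by rewrite lerD2l ler_pdivrMr// ler_peMr ?sqr_ge0// ler1n.
have h2 : `|r (a m - z) h| <= 2 * e * snorm r h.
  apply: le_trans (cauchy_schwarz_abs _ _ _) _.
  by apply: ler_wpM2r => //; exact: az.
have -> : r z h - f h = (r (a m) h - f h) - r (a m - z) h.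
  by rewrite !expand_rform; ring.
apply: le_trans (ler_normB _ _) _; apply: le_trans (lerD h1 h2) _.
by have := mulr_ge0 (ltW e0) s0; lra.
Qed.

End Riesz.

(** * Hilbert spaces, tuples and operators defined by forms *)

Section HilbertForm.
Variables (R : realType) (H : hilbertSpace R).
Implicit Types g h : H.

Let hformDl g h k : complex.Re (@inner R H (g + h) k) =
  complex.Re (@inner R H g k) + complex.Re (@inner R H h k).
Proof. by rewrite linearDl raddfD. Qed.

Let hformZl (t : R) g h : complex.Re (@inner R H (t%:C *: g) h) =
  t * complex.Re (@inner R H g h).
Proof.
by rewrite linearZl_LR /=; case: (inner _ _) => x y /=; rewrite mul0r subr0.
Qed.

Let hformI g h : complex.Re (@inner R H ('i%C *: g) ('i%C *: h)) =
  complex.Re (@inner R H g h).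
Proof.
rewrite linearZl_LR linearZr_LR /=; case: (inner _ _) => x y /=.
by ring.
Qed.

Let hformC g h : complex.Re (@inner R H g h) = complex.Re (@inner R H h g).
Proof.
have -> : @inner R H g h = (@inner R H h g)^*.
  by rewrite [LHS](hermitian_subproof g h) expr0 mul1r.
by case: (@inner R H h g).
Qed.

Let hform_ge0 h : 0 <= complex.Re (@inner R H h h).
Proof.
have : 0 <= @inner R H h h by rewrite innerE exprn_ge0.
by rewrite lecE => /andP[].
Qed.

Definition hform : semi_inner H :=
  SemiInner hformDl hformZl hformI hformC hform_ge0.

Lemma hnormE h : `|h| = (snorm hform h)%:C.
Proof.
have [x hx] : exists x : R, `|h| = x%:C.
  by exists (complex.Re `|h|); rewrite RRe_real// normr_real.
have x0 : 0 <= x by rewrite -lecR -hx normr_ge0.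
by rewrite hx /snorm /= innerE hx -rmorphXn /= sqrtr_sqr ger0_norm.
Qed.

Lemma hnorm0_eq0 h : snorm hform h = 0 -> h = 0.
Proof. by move=> h0; apply/normr0_eq0; rewrite hnormE h0. Qed.

Lemma hform_ext (V : Type) (p : V -> H) g h : (forall k, exists a, k = p a) ->
  (forall a, hform g (p a) = hform h (p a)) -> g = h.
Proof.
move=> ps e; apply/eqP; rewrite -subr_eq0; apply/eqP/hnorm0_eq0.
have [a ha] := ps (g - h).
by rewrite /snorm {2}ha rformDl rformNl e subrr sqrtr0.
Qed.

Lemma bounded_opP (f : {linear H -> H}) :
  bounded_op f <-> exists k : R, forall h, snorm hform (f h) <= k * snorm hform h.
Proof.
by split=> -[k fk]; exists k => h; have := fk h; rewrite !hnormE -rmorphM lecR.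
Qed.

End HilbertForm.

Definition mk_linear (R : pzRingType) (U W : lmodType R) (f : U -> W)
    (fl : linear f) : {linear U -> W} :=
  HB.pack f (GRing.isLinear.Build R U W *:%R f fl).

Section TupleForm.
Variables (R : realType) (V : lmodType R[i]) (r : semi_inner V) (n : nat).
Let tf (a b : 'I_n -> V) := \sum_i r (a i) (b i).

Let tfDl a b c : tf (a + b) c = tf a c + tf b c.
Proof. by rewrite -big_split /=; apply: eq_bigr => i _; rewrite -rformDl. Qed.

Let tfZl (t : R) a b : tf (t%:C *: a) b = t * tf a b.
Proof. by rewrite mulr_sumr; apply: eq_bigr => i _; rewrite -rformZl. Qed.

Let tfI a b : tf ('i%C *: a) ('i%C *: b) = tf a b.
Proof. by apply: eq_bigr => i _; rewrite -[RHS]rformI. Qed.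

Let tfC a b : tf a b = tf b a.
Proof. by apply: eq_bigr => i _; rewrite rformC. Qed.

Let tf_ge0 a : 0 <= tf a a.
Proof. by apply: sumr_ge0 => i _; apply: rform_ge0. Qed.

(** The form of the direct sum of n copies of V. *)
Definition tuple_form : semi_inner ('I_n -> V) :=
  SemiInner tfDl tfZl tfI tfC tf_ge0.

Lemma tuple_formE a b : tuple_form a b = \sum_i r (a i) (b i).
Proof. by []. Qed.

Lemma snorm_tuple a i : snorm r (a i) <= snorm tuple_form a.
Proof.
rewrite ler_wsqrtr// tuple_formE (bigD1 i)//= lerDl.
by apply: sumr_ge0 => j _; apply: rform_ge0.
Qed.

End TupleForm.

Lemma l2normE (R : realType) (H : hilbertSpace R) n (h : 'cV[H]_n) :
  l2norm h = snorm (tuple_form (hform H) n) (h^~ 0).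
Proof.
congr (Num.sqrt _); apply: eq_bigr => i _.
by rewrite hnormE /= snorm2.
Qed.

(** Bounded real-bilinear forms invariant under multiplication of both arguments
by i: the real parts of bounded sesquilinear forms. *)
Record bounded_form (R : realType) (V : lmodType R[i]) (r : semi_inner V) :=
  BoundedForm {
  bform :> V -> V -> R;
  bbound : R;
  bformDl : forall a b c, bform (a + b) c = bform a c + bform b c;
  bformDr : forall a b c, bform a (b + c) = bform a b + bform a c;
  bformZl : forall (t : R) a b, bform (t%:C *: a) b = t * bform a b;
  bformZr : forall (t : R) a b, bform a (t%:C *: b) = t * bform a b;
  bformI : forall a b, bform ('i%C *: a) ('i%C *: b) = bform a b;
  bform_le : forall a b, `|bform a b| <= bbound * snorm r a * snorm r b }.

Section Lift.
Variables (R : realType) (V : lmodType R[i]) (r : semi_inner V).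
Hypothesis rc : seq_complete r.
Variables (H : hilbertSpace R) (p : V -> H).
Hypotheses (p_linear : linear p) (p_surj : forall h, exists a, h = p a).
Hypothesis p_inner : forall a b, @inner R H (p a) (p b) = cform r a b.

Lemma hform_proj a b : hform H (p a) (p b) = r a b.
Proof. by rewrite /= p_inner. Qed.

Lemma hnorm_proj a : snorm (hform H) (p a) = snorm r a.
Proof. by rewrite /snorm hform_proj. Qed.

(** Riesz's theorem applied to the functionals B a, for each a.  Real-linearity
and the invariance of B under i make the resulting map complex-linear. *)
Lemma operator_of_form (B : bounded_form r) : exists T : {linear H -> H},
  bounded_op T /\ forall a b, hform H (T (p a)) (p b) = B a b.
Proof.
have /choice[z zE] a : exists z, forall b, B a b = r z b.
  exact: (riesz (bformDr B a) (fun t => bformZr B t a) (bform_le B a) rc).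
have /choice[q qE] := p_surj.
pose T h := p (z (q h)).
have TE h b : hform H (T h) (p b) = B (q h) b by rewrite hform_proj -zE.
have pB a b : p (a - b) = p a - p b.
  by have := p_linear (-1) b a; rewrite !scaleN1r ![- _ + _]addrC.
have Bq a b : B (q (p a)) b = B a b.
  apply/eqP; rewrite -subr_eq0 -mulN1r -bformZl -bformDl rmorphN1 scaleN1r -normr_le0.
  apply: le_trans (bform_le B _ _) _.
  by rewrite -hnorm_proj pB -qE subrr snorm0 mulr0 mul0r.
have p0 : p 0 = 0 by rewrite -[X in p X](subrr 0) pB subrr.
have pZ c a : p (c *: a) = c *: p a by have := p_linear c a 0; rewrite p0 !addr0.
have BIr a b : B ('i%C *: a) b = - B a ('i%C *: b).
  rewrite -(bformI B) i_scale_i -scaleN1r -(rmorphN1 (real_complex R)).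
  by rewrite bformZl mulN1r.
have Tl : linear T.
  move=> c g h; apply: (hform_ext p_surj) => b; rewrite TE.
  have [a ->] := p_surj g; have [a' ->] := p_surj h.
  rewrite -p_linear Bq [c *: T _]complex_scaleE !rformDl !rformZl rformIr -pZ.
  have TEp k l : hform H (T (p k)) (p l) = B k l by rewrite -Bq; exact: TE.
  rewrite [c *: a]complex_scaleE !bformDl !bformZl BIr; symmetry.
  by congr (_ * _ + _ * - _ + _); apply: TEp.
exists (mk_linear Tl); split; last by move=> a b; rewrite -Bq; exact: TE.
apply/bounded_opP; exists (bbound B) => h; rewrite [mk_linear _ h]/(T h).
have [T0|T0] := eqVneq (snorm (hform H) (T h)) 0.
  rewrite T0; have [a ->] := p_surj h; rewrite hnorm_proj.
  have [->|a0] := eqVneq (snorm r a) 0; first by rewrite mulr0.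
  have Baa := bform_le B a a; have : 0 <= bbound B * snorm r a * snorm r a.
    exact: le_trans (normr_ge0 _) Baa.
  by rewrite pmulr_lge0// lt_def a0 snorm_ge0.
rewrite -(@ler_pM2r _ (snorm (hform H) (T h))) ?lt_def ?T0 ?snorm_ge0//.
rewrite -expr2 snorm2; have [b Tb] := p_surj (T h).
have -> : hform H (T h) (T h) = B (q h) b by rewrite {2}Tb; exact: TE.
rewrite Tb {2}(qE h) !hnorm_proj.
exact: le_trans (ler_norm _) (bform_le B _ _).
Qed.

End Lift.

(** * The kernel of a form in an ultrapower *)

Lemma limit_ext (R : realType) (F : set_system nat) (u s : nat -> R) (l : R) :
  (forall k, u k = s k) -> u @ F --> l -> s @ F --> l.
Proof. by move=> /funext ->. Qed.

Lemma limit_unique (R : realType) (F : set_system nat) (u : nat -> R) (l m : R) :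
  ProperFilter F -> u @ F --> l -> u @ F --> m -> l = m.
Proof. by move=> FF; apply: cvg_unique. Qed.

(** The image of U on a compact interval has a cluster point, and an ultrafilter
converges to each of its cluster points. *)
Lemma ultra_bounded_cvg (R : realType) (U : set_system nat) (u : nat -> R) (M : R) :
  UltraFilter U -> (forall k, `|u k| <= M) -> cvg (u @ U).
Proof.
move=> UU uM; have : compact `[-M, M]%classic by exact: segment_compact.
move=> /(_ (u @ U)) [|l [_ ul]].
  by apply: (@filterE _ U) => k; rewrite /= in_itv /= -ler_norml uM.
apply/cvg_ex; exists l => B Bl; have [//|UB] := in_ultra_setVsetC (u @^-1` B) UU.
by have [x [/= nBx Bx]] := ul (~` B) B UB Bl.
Qed.

Section Ultrapower.
Variables (R : realType) (U : set_system nat).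
Hypotheses (UU : UltraFilter U) (Ufree : \oo `<=` U).
Variables (W : lmodType R[i]) (w D : semi_inner W).
Hypothesis Dw : forall a, D a a <= w a a.

Let snormDw a : snorm D a <= snorm w a.
Proof. exact: ler_wsqrtr. Qed.

(** The bounded sequences on which the form D vanishes in the limit along U.
For the form D(a,b) = <a,b> - <v a, v b> of a contraction v, these represent the
kernel of 1 - v* v in the ultrapower. *)
Definition ultra_mem : pred (nat -> W) := fun a =>
  `[< (exists M, forall k, snorm w (a k) <= M) /\
      (fun k => snorm D (a k)) @ U --> (0 : R) >].

Record ultra_kernel := UltraKernel {
  ultra_seq :> nat -> W;
  ultra_seqP : ultra_mem ultra_seq }.

Lemma null_le (u s : nat -> R) : (forall k, 0 <= u k <= s k) ->
  s @ U --> (0 : R) -> u @ U --> (0 : R).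
Proof.
move=> us s0; apply: (@squeeze_cvgr _ U _ R (fun=> 0) s u) => //.
  exact: nearW.
exact: cvg_cst.
Qed.

Lemma ultra_mem_submod : submod_closed ultra_mem.
Proof.
split=> [|z a b /asboolP[[M aM] a0] /asboolP[[N bN] b0]]; apply/asboolP.
  split; first by exists 0 => k; rewrite snorm0.
  rewrite (_ : (fun _ => _) = fun=> 0); first exact: cvg_cst.
  by apply/funext => k; rewrite snorm0.
have [t zt] : exists t : R, forall (r : semi_inner W) c,
    snorm r (z *: c) = t * snorm r c.
  exists (Num.sqrt (complex.Re z ^+ 2 + complex.Im z ^+ 2)) => r c.
  by apply: complexI; rewrite snormZ rmorphM normc_def.
split.
  exists (`|t| * M + N) => k; apply: le_trans (snormD _ _ _) _.
  rewrite lerD// zt; apply: le_trans (ler_norm _) _.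
  by rewrite normrM ler_wpM2l// ger0_norm// snorm_ge0.
apply: (@null_le _ (fun k => t * snorm D (a k) + snorm D (b k))).
  by move=> k; rewrite snorm_ge0 -zt snormD.
rewrite -[X in _ --> X](addr0 (0 : R)) -{1}(mulr0 t).
by apply: cvgD => //; apply: cvgM => //; apply: cvg_cst.
Qed.
HB.instance Definition _ :=
  GRing.isSubmodClosed.Build R[i] (nat -> W) ultra_mem ultra_mem_submod.
HB.instance Definition _ := [isSub of ultra_kernel for ultra_seq].
HB.instance Definition _ := [Choice of ultra_kernel by <:].
HB.instance Definition _ := [SubChoice_isSubLmodule of ultra_kernel by <:].

Lemma ultra_bounded (a : ultra_kernel) : exists M, forall k, snorm w (a k) <= M.
Proof. by have /asboolP[] := ultra_seqP a. Qed.

Lemma ultra_null (a : ultra_kernel) : (fun k => snorm D (a k)) @ U --> (0 : R).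
Proof. by have /asboolP[] := ultra_seqP a. Qed.

Arguments ultra_null : clear implicits.

Lemma ultraD (a b : ultra_kernel) k : (a + b) k = a k + b k. Proof. by []. Qed.
Lemma ultraZ z (a : ultra_kernel) k : (z *: a) k = z *: a k. Proof. by []. Qed.

Lemma lim_eq (s u : nat -> R) l :
  u @ U --> l -> (forall k, s k = u k) -> lim (s @ U) = l.
Proof. by move=> ul /funext ->; apply: cvg_lim. Qed.

(** A bounded form on W induces one on the ultrapower, by taking limits along
U of its values on the terms of two sequences. *)
Section LimitForm.
Variable B : bounded_form w.

Definition lim_form (a b : ultra_kernel) : R := lim ((fun k => B (a k) (b k)) @ U).

Lemma lim_form_cvg (a b : ultra_kernel) : (fun k => B (a k) (b k)) @ U --> lim_form a b.
Proof.
have [M aM] := ultra_bounded a; have [N bN] := ultra_bounded b.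
apply: (@ultra_bounded_cvg _ _ _ (`|bbound B| * M * N)) => // k.
apply: le_trans (bform_le B _ _) _.
apply: (@le_trans _ _ (`|bbound B| * snorm w (a k) * snorm w (b k))).
  by rewrite !ler_wpM2r ?snorm_ge0// ler_norm.
by rewrite !ler_pM// ?mulr_ge0 ?snorm_ge0.
Qed.

Arguments lim_form_cvg : clear implicits.

Lemma lim_formDl a b c : lim_form (a + b) c = lim_form a c + lim_form b c.
Proof.
apply: (lim_eq (cvgD (lim_form_cvg a c) (lim_form_cvg b c))) => k.
by rewrite ultraD bformDl.
Qed.

Lemma lim_formDr a b c : lim_form a (b + c) = lim_form a b + lim_form a c.
Proof.
apply: (lim_eq (cvgD (lim_form_cvg a b) (lim_form_cvg a c))) => k.
by rewrite ultraD bformDr.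
Qed.

Lemma lim_formZl (t : R) a b : lim_form (t%:C *: a) b = t * lim_form a b.
Proof.
apply: (lim_eq (cvgM (@cvg_cst _ t _ U _) (lim_form_cvg a b))) => k.
by rewrite ultraZ bformZl.
Qed.

Lemma lim_formZr (t : R) a b : lim_form a (t%:C *: b) = t * lim_form a b.
Proof.
apply: (lim_eq (cvgM (@cvg_cst _ t _ U _) (lim_form_cvg a b))) => k.
by rewrite ultraZ bformZr.
Qed.

Lemma lim_formI a b : lim_form ('i%C *: a) ('i%C *: b) = lim_form a b.
Proof.
by apply: (lim_eq (lim_form_cvg a b)) => k; rewrite !ultraZ bformI.
Qed.

End LimitForm.
Arguments lim_form_cvg : clear implicits.

Lemma cauchy_schwarz_bound a b : `|w a b| <= 1 * snorm w a * snorm w b.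
Proof. by rewrite mul1r cauchy_schwarz_abs. Qed.

Definition form_of_semi_inner := BoundedForm (rformDl w) (rformDr w)
  (rformZl w) (rformZr w) (rformI w) cauchy_schwarz_bound.

Let wlim := lim_form form_of_semi_inner.

Let wlimC a b : wlim a b = wlim b a.
Proof. by congr lim; congr (_ @ U); apply/funext => k; rewrite /= rformC. Qed.

Let wlim_ge0 a : 0 <= wlim a a.
Proof.
apply: (cvgr_to_ge (lim_form_cvg _ a a)); apply: nearW => k.
exact: rform_ge0.
Qed.

Definition ultra_form : semi_inner ultra_kernel :=
  SemiInner (lim_formDl _) (lim_formZl _) (lim_formI _) wlimC wlim_ge0.

Lemma ultra_form_cvg (a b : ultra_kernel) :
  (fun k => w (a k) (b k)) @ U --> ultra_form a b.
Proof. exact: lim_form_cvg form_of_semi_inner a b. Qed.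

Arguments ultra_form_cvg : clear implicits.

Lemma ultra_snorm_cvg (a : ultra_kernel) :
  (fun k => snorm w (a k)) @ U --> snorm ultra_form a.
Proof.
exact: (continuous_cvg _ (@sqrt_continuous R _) (ultra_form_cvg a a)).
Qed.

Arguments ultra_snorm_cvg : clear implicits.

Lemma lim_form_le (B : bounded_form w) a b :
  `|lim_form B a b| <= bbound B * snorm ultra_form a * snorm ultra_form b.
Proof.
apply: (ler_cvg_to (cvg_norm (lim_form_cvg B a b))
  (cvgM (cvgM (cvg_cst (bbound B)) (ultra_snorm_cvg a)) (ultra_snorm_cvg b))).
by apply: nearW => k; apply: bform_le.
Qed.

Definition ultra_bounded_form (B : bounded_form w) : bounded_form ultra_form :=
  BoundedForm (lim_formDl B) (lim_formDr B) (lim_formZl B) (lim_formZr B)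
    (lim_formI B) (lim_form_le B).

(** A diagonal argument.  The set S m of indices at which the terms of the first
m + 1 sequences are almost as close as their classes is in U; the limit takes at
the index i the value of the sequence number N i, for the largest N i <= i such
that i is in S (N i).  As D <= w, this limit is again null for D. *)
Lemma ultra_complete : seq_complete ultra_form.
Proof.
move=> a aC; pose e m : R := m.+1%:R^-1.
have e0 m : 0 < e m by rewrite invr_gt0.
have e_anti m n : (m <= n)%N -> e n <= e m.
  by move=> mn; rewrite lef_pV2 ?posrE// ler_nat.
pose S m i := forall j l, (j <= m)%N -> (l <= m)%N ->
  snorm w (a j i - a l i) <= e j + e l + e m.
have SU m : U (S m).
  have Sjl j l : U (fun i => snorm w (a j i - a l i) <= e j + e l + e m).
    have := ultra_snorm_cvg (a j - a l).
    move=> /cvgr_dist_le /(_ _ (e0 m)); apply: filterS => i /=.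
    have := aC j l; rewrite -/(e j) -/(e l) => h1.
    by rewrite ler_norml => /andP[h2 _]; move: h2; rewrite lerBrDl lerBlDr
      => h2; apply: le_trans h2 _; rewrite lerD.
  have : U (fun i => forall jl : 'I_m.+1 * 'I_m.+1,
    snorm w (a jl.1 i - a jl.2 i) <= e jl.1 + e jl.2 + e m).
    by apply: filter_forall => jl; exact: Sjl.
  apply: filterS => i h j l jm lm.
  exact: (h (Ordinal (jm : (j < m.+1)%N), Ordinal (lm : (l < m.+1)%N))).
have maxS i : exists n, S n i /\ forall m, (m <= i)%N -> S m i -> (m <= n)%N.
  have P0 : exists n, `[< (n <= i)%N /\ S n i >].
    exists 0%N; apply/asboolP; split=> // j l; rewrite !leqn0 => /eqP-> /eqP->.
    by rewrite subrr snorm0 !addr_ge0// ltW.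
  have Pi n : `[< (n <= i)%N /\ S n i >] -> (n <= i)%N by move=> /asboolP[].
  case: (ex_maxnP P0 Pi) => n /asboolP[ni Sn] nmax; exists n; split=> // m mi Sm.
  by apply: nmax; apply/asboolP.
have [N NP] := choice maxS.
pose b i := a (N i) i.
have abU m n : (m <= n)%N -> U (fun i => snorm w (a m i - b i) <= e m + 2 * e n).
  move=> mn; have large : U (fun i => (n <= i)%N) by apply: Ufree; exists n.
  apply: filterS (filterI large (SU n)) => i [ni Sn]; have [SN Nmax] := NP i.
  have nN := Nmax _ ni Sn.
  apply: le_trans (SN _ _ (leq_trans mn nN) (leqnn _)) _.
  by have := e_anti _ _ nN; lra.
have b_mem : ultra_mem b.
  apply/asboolP; split.
    have [M aM] := ultra_bounded (a 0%N); exists (M + 3) => i.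
    rewrite -(subrK (a 0%N i) (b i)) addrC; apply: le_trans (snormD _ _ _) _.
    rewrite lerD// snorm_sub; have [SN _] := NP i.
    apply: le_trans (SN _ _ (leq0n _) (leqnn _)) _.
    have e00 : e 0%N = 1 by rewrite /e invr1.
    by have := e_anti _ _ (leq0n (N i)); rewrite e00; lra.
  apply/cvgr0Pnorm_lt => d d0.
  have [m em] : exists m, e m < d / 4 by apply: inv_nat_lt; lra.
  have am : U (fun i => `|snorm D (a m i)| < e m).
    exact: (cvgr0_norm_lt _ (ultra_null (a m)) _ (e0 m)).
  apply: filterS (filterI am (abU m m (leqnn m))) => i [/= h1 h2].
  rewrite ger0_norm ?snorm_ge0// in h1 *.
  have := snormB_tri D (b i) (a m i); have := snormDw (b i - a m i).
  by rewrite (snorm_sub w) (ger0_norm (snorm_ge0 _ _)); lra.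
exists (UltraKernel b_mem) => m.
(* 2 m + 1 makes e m + 2 e (2 m + 1) equal to the required bound 2 e m. *)
have m2 : (m <= m.*2.+1)%N by rewrite -addnn leqW// leq_addr.
apply: (cvgr_to_le (ultra_snorm_cvg (a m - UltraKernel b_mem))).
apply: filterS (abU _ _ m2) => i /= h; apply: le_trans h _.
have -> : e m.*2.+1 = e m / 2.
  rewrite /e -invfM; congr (_^-1); rewrite -natrM.
  by congr (_%:R); rewrite muln2 -doubleS.
by rewrite -/(e m); lra.
Qed.

End Ultrapower.

(** * Matrices of operators and matrix norms *)

Section OperatorMatrices.
Variables (R : realType) (H : hilbertSpace R) (n : nat).
Implicit Types (A : 'M[{linear H -> H}]_n) (a b : 'I_n -> H).
Local Notation tnorm := (snorm (tuple_form (hform H) n)).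

Definition opfun A a : 'I_n -> H := fun i => \sum_j A i j (a j).

Lemma l2norm_apply A h : l2norm (opmx_apply A h) = tnorm (opfun A (h^~ 0)).
Proof. by rewrite l2normE; congr snorm; apply/funext => i; rewrite mxE. Qed.

Lemma opfunZ A (z : R[i]) a : opfun A (z *: a) = z *: opfun A a.
Proof.
apply/funext => i; rewrite /opfun.
have -> : (z *: (fun i => \sum_j A i j (a j))) i = z *: \sum_j A i j (a j) by [].
by rewrite scaler_sumr; apply: eq_bigr => j _; rewrite -linearZ.
Qed.

Lemma opfun0 A : opfun A 0 = 0.
Proof. by apply/funext => i; apply: big1 => j _; rewrite linear0. Qed.

Lemma tnorm_le_sum a : tnorm a <= \sum_i snorm (hform H) (a i).
Proof.
set S := \sum_i _; have S0 : 0 <= S by apply: sumr_ge0 => i _; apply: snorm_ge0.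
rewrite -ler_sqr ?nnegrE ?snorm_ge0// snorm2 tuple_formE expr2 {1}/S mulr_suml.
apply: ler_sum => i _; rewrite -snorm2 expr2 ler_wpM2l ?snorm_ge0//.
by rewrite /S (bigD1 i)//= lerDl; apply: sumr_ge0 => j _; apply: snorm_ge0.
Qed.

Lemma snorm_sum (V : lmodType R[i]) (r : semi_inner V) I (s : seq I) (F : I -> V) :
  snorm r (\sum_(i <- s) F i) <= \sum_(i <- s) snorm r (F i).
Proof.
elim/big_rec2: _ => [|i x y _ xy]; first by rewrite snorm0.
by apply: le_trans (snormD _ _ _) _; rewrite lerD2l.
Qed.

Lemma opfun_bounded A : (forall i j, bounded_op (A i j)) ->
  exists M, forall a, tnorm (opfun A a) <= M * tnorm a.
Proof.
move=> Ab; have /choice[k kP] (ij : 'I_n * 'I_n) : exists k, forall h,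
    snorm (hform H) (A ij.1 ij.2 h) <= k * snorm (hform H) h.
  exact/bounded_opP.
exists (\sum_i \sum_j `|k (i, j)|) => a.
apply: le_trans (tnorm_le_sum _) _; rewrite mulr_suml; apply: ler_sum => i _.
apply: le_trans (snorm_sum _ _ _) _; rewrite mulr_suml; apply: ler_sum => j _.
apply: le_trans (kP (i, j) _) _.
apply: le_trans (ler_norm _) _; rewrite normrM ler_wpM2l//.
by rewrite ger0_norm ?snorm_ge0// snorm_tuple.
Qed.

Lemma ball_image_nonempty A :
  [set l2norm (opmx_apply A h) | h in [set h | l2norm h <= 1]] !=set0.
Proof.
have col0 : (fun i => (0 : 'cV[H]_n) i 0) = 0 by apply/funext => i; rewrite mxE.
by exists (l2norm (opmx_apply A 0)), 0; rewrite //= l2normE col0 snorm0.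
Qed.

(** The norm of a matrix of bounded operators is its operator norm on H^n; this
lemma, opfun_le and opfun_near are the form in which it is used. *)
Lemma opmx_norm_le A c : 0 <= c ->
  (forall a, tnorm (opfun A a) <= c * tnorm a) -> opmx_norm A <= c.
Proof.
move=> c0 Ac; apply: ge_sup; first exact: ball_image_nonempty.
move=> _ [h /= h1 <-]; rewrite l2norm_apply; apply: le_trans (Ac _) _.
by rewrite -[leRHS]mulr1 ler_wpM2l// -l2normE.
Qed.

Section Bounded.
Variable A : 'M[{linear H -> H}]_n.
Hypothesis A_bounded : forall i j, bounded_op (A i j).

Let has_supA : has_sup [set l2norm (opmx_apply A h) | h in [set h | l2norm h <= 1]].
Proof.
split; first exact: ball_image_nonempty.
have [M AM] := opfun_bounded A_bounded; exists `|M| => _ [h /= h1 <-].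
rewrite l2norm_apply; apply: le_trans (AM _) _; apply: le_trans (ler_norm _) _.
by rewrite normrM -[leRHS]mulr1 ler_wpM2l// ger0_norm ?snorm_ge0// -l2normE.
Qed.

Lemma opfun_le1 a : tnorm a <= 1 -> tnorm (opfun A a) <= opmx_norm A.
Proof.
move=> a1; have aE : (fun i => (\col_i a i) i 0) = a by apply/funext => i; rewrite mxE.
apply: sup_upper_bound => //; exists (\col_i a i); last by rewrite l2norm_apply aE.
by rewrite /= l2normE aE.
Qed.

Lemma opmx_norm_ge0 : 0 <= opmx_norm A.
Proof.
by have := @opfun_le1 0; rewrite opfun0 snorm0 => h; exact: h.
Qed.

Lemma opfun_le a : tnorm (opfun A a) <= opmx_norm A * tnorm a.
Proof.
have [M AM] := opfun_bounded A_bounded.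
have [a0|a0] := eqVneq (tnorm a) 0; first by have := AM a; rewrite a0 !mulr0.
have agt : 0 < tnorm a by rewrite lt_def a0 snorm_ge0.
have := @opfun_le1 ((tnorm a)^-1%:C *: a).
rewrite opfunZ !snormZr ger0_norm ?invr_ge0 ?snorm_ge0// mulVf// => /(_ (lexx _)).
by rewrite mulrC ler_pdivrMr.
Qed.

Lemma opfun_near c : c < opmx_norm A -> exists2 a, tnorm a <= 1 & c < tnorm (opfun A a).
Proof.
move=> cA; have e0 : 0 < opmx_norm A - c by rewrite subr_gt0.
have [_ [h /= h1 <-]] := sup_adherent e0 has_supA.
rewrite -/(opmx_norm A) subKr l2norm_apply => ch.
by exists (h^~ 0); rewrite // -l2normE.
Qed.

End Bounded.
End OperatorMatrices.

Section CompleteIsometry.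
Variables (R : realType) (X : operatorSpace R) (H : hilbertSpace R).
Variable T : X -> {linear H -> H}.
Hypothesis TP : complete_isometry (@mnorm R X) T.
Local Notation tnorm n := (snorm (tuple_form (hform H) n)).
Local Notation act x := (opfun (map_mx T x)).

Let T_linear : linear (fun x => T x : H -> H). Proof. by case: TP. Qed.

Lemma repD x y h : T (x + y) h = T x h + T y h.
Proof.
by have := congr1 (fun f => f h) (T_linear 1 x y); rewrite !scale1r.
Qed.

Lemma rep0 h : T 0 h = 0.
Proof. by apply: (@addrI _ (T 0 h)); rewrite -repD !addr0. Qed.

Lemma repZ (z : R[i]) x h : T (z *: x) h = z *: T x h.
Proof.
have := congr1 (fun f => f h) (T_linear z x 0); rewrite addr0 => ->.
by rewrite -[RHS]addr0 -[in RHS](rep0 h).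
Qed.

Lemma actE n (x : 'M[X]_n) a i : act x a i = \sum_j T (x i j) (a j).
Proof. by apply: eq_bigr => j _; rewrite mxE. Qed.

Lemma rep_bounded n (x : 'M[X]_n) i j : bounded_op (map_mx T x i j).
Proof. by rewrite mxE; case: TP. Qed.

Lemma act_le n (x : 'M[X]_n) a : (0 < n)%N -> tnorm n (act x a) <= mnorm x * tnorm n a.
Proof. by move=> n0; case: TP => _ _ <- //; apply/opfun_le/rep_bounded. Qed.

Lemma mnorm_ge0 n (x : 'M[X]_n) : (0 < n)%N -> 0 <= mnorm x.
Proof. by move=> n0; case: TP => _ _ <- //; apply/opmx_norm_ge0/rep_bounded. Qed.

Lemma mnorm_le n (x : 'M[X]_n) c : (0 < n)%N -> 0 <= c ->
  (forall a, tnorm n (act x a) <= c * tnorm n a) -> mnorm x <= c.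
Proof. by move=> n0 c0 h; case: TP => _ _ <- //; apply/opmx_norm_le. Qed.

Lemma act_near n (x : 'M[X]_n) c : (0 < n)%N -> c < mnorm x ->
  exists2 a, tnorm n a <= 1 & c < tnorm n (act x a).
Proof.
by move=> n0 cx; apply: opfun_near; [apply: rep_bounded|case: TP => _ _ ->].
Qed.

Lemma act_scalar n (v : X) a i : act (v%:M : 'M[X]_n) a i = T v (a i).
Proof.
rewrite actE (bigD1 i)//= mxE eqxx mulr1n big1 ?addr0// => j ji.
by rewrite mxE eq_sym (negbTE ji) mulr0n rep0.
Qed.

Lemma act_scale n (x : 'M[X]_n) (z : R[i]) a :
  act (map_mx (fun y => z *: y) x) a = z *: act x a.
Proof.
apply/funext => i; rewrite actE.
have -> : (z *: act x a) i = z *: (act x a i) by [].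
by rewrite actE scaler_sumr; apply: eq_bigr => j _; rewrite mxE repZ.
Qed.

Lemma mnorm_scale n (x : 'M[X]_n) (s : R) : (0 < n)%N -> 0 < s ->
  mnorm (map_mx (fun y => s%:C *: y) x) = s * mnorm x.
Proof.
move=> n0 s0; apply/eqP; rewrite eq_le; apply/andP; split.
  apply: mnorm_le => // [|a]; first by rewrite mulr_ge0 ?(ltW s0) ?mnorm_ge0.
  by rewrite act_scale snormZr gtr0_norm// -mulrA ler_pM2l// act_le.
rewrite -ler_pdivlMl//; apply: mnorm_le => // [|a].
  by rewrite mulr_ge0 ?invr_ge0 ?(ltW s0) ?mnorm_ge0.
rewrite -mulrA ler_pdivlMl//; apply: le_trans (act_le _ _ n0).
by rewrite act_scale snormZr gtr0_norm.
Qed.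

Section Block.
Variables (n : nat) (v : X) (x : 'M[X]_n) (a : 'I_(n + n) -> H).
Let block := block_mx v%:M x 0 v%:M : 'M[X]_(n + n).
Let al i := a (lshift n i).
Let ar i := a (rshift n i).

Lemma act_block_l i : act block a (lshift n i) = T v (al i) + act x ar i.
Proof.
rewrite actE big_split_ord /= -(act_scalar v al) !actE; congr (_ + _).
  by apply: eq_bigr => j _; rewrite block_mxEul.
by apply: eq_bigr => j _; rewrite block_mxEur.
Qed.

Lemma act_block_r i : act block a (rshift n i) = T v (ar i).
Proof.
rewrite actE big_split_ord /= big1 ?add0r => [|j _]; last first.
  by rewrite block_mxEdl mxE rep0.
rewrite -(act_scalar v ar) actE.
by apply: eq_bigr => j _; rewrite block_mxEdr.
Qed.

Lemma tuple_form_split (b : 'I_(n + n) -> H) :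
  tuple_form (hform H) _ b b =
  tuple_form (hform H) _ (fun i => b (lshift n i)) (fun i => b (lshift n i)) +
  tuple_form (hform H) _ (fun i => b (rshift n i)) (fun i => b (rshift n i)).
Proof. by rewrite !tuple_formE big_split_ord. Qed.

Lemma act_block_form : tuple_form (hform H) _ (act block a) (act block a) =
  tuple_form (hform H) _ (fun i => T v (al i) + act x ar i)
                         (fun i => T v (al i) + act x ar i) +
  tuple_form (hform H) _ (fun i => T v (ar i)) (fun i => T v (ar i)).
Proof.
rewrite tuple_form_split; congr (_ + _); apply: eq_bigr => i _.
  by rewrite act_block_l.
by rewrite act_block_r.
Qed.

End Block.
End CompleteIsometry.

(** * The block inequality in a unital operator space *)

Section Forward.
Variables (R : realType) (X : operatorSpace R) (v : X).

(** The vector with components x b / s and b, where s = |x b|, is mapped to the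
one with components (1 + s) (x b / s) and b; with q = |b|^2 <= 1 the quotient of
the squared norms is ((1 + s)^2 + q) / (1 + q) >= 1 + s. *)
Lemma unital_block_norm (n : nat) (x : 'M[X]_n) :
  unital_operator_space v -> (0 < n)%N ->
  1 + mnorm x <= mnorm (block_mx v%:M x 0 v%:M) ^+ 2.
Proof.
move=> [H [T [[h0 h0n] TP Tv]]] n0.
set N := mnorm (block_mx _ _ _ _).
have nn0 : (0 < n + n)%N by rewrite addn_gt0 n0.
have N0 : 0 <= N by exact: (mnorm_ge0 TP).
have block_le a b xb : xb = opfun (map_mx T x) b ->
    tuple_form (hform H) n (a + xb) (a + xb) + tuple_form (hform H) n b b
    <= N ^+ 2 * (tuple_form (hform H) n a a + tuple_form (hform H) n b b).
  move=> ->; pose c i := match fintype.split i with inl j => a j | inr j => b j end.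
  have := act_le TP (block_mx v%:M x 0 v%:M) c nn0.
  rewrite -ler_sqr ?nnegrE ?mulr_ge0 ?snorm_ge0// exprMn !snorm2.
  rewrite act_block_form// (tuple_form_split (n := n)).
  have cl : (fun i => c (lshift n i)) = a.
    by apply/funext => i; rewrite /c (unsplitK (inl i)).
  have cr : (fun i => c (rshift n i)) = b.
    by apply/funext => i; rewrite /c (unsplitK (inr i)).
  rewrite cl cr; suff -> : (fun i => T v (c (lshift n i)) + opfun (map_mx T x) b i)
     = a + opfun (map_mx T x) b.
    by suff -> : (fun i => T v (c (rshift n i))) = b;
      last by rewrite -[RHS]cr; apply/funext => i; rewrite Tv.
  by rewrite -[in RHS]cl; apply/funext => i; rewrite Tv.
(* The block operator fixes the vectors with zero second component. *)
have N1 : 1 <= N ^+ 2.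
  have := block_le (fun=> h0) 0 0; rewrite opfun0 => /(_ erefl).
  rewrite addr0 rform0l addr0.
  rewrite -[leLHS]mul1r ler_pM2r// lt_def rform_ge0 andbT.
  rewrite -snorm2 sqrf_eq0; apply/negP => /eqP h00.
  have := snorm_tuple (hform H) (fun=> h0) (Ordinal n0); rewrite h00 => h01.
  move/negP: h0n; apply; apply/eqP/hnorm0_eq0/eqP.
  by rewrite eq_le h01 snorm_ge0.
rewrite leNgt; apply/negP => Nlt.
have [|b b1] := @act_near _ _ _ _ TP n x (N ^+ 2 - 1) n0; first by lra.
set xb := opfun _ _; set s := snorm _ xb => sN.
have s0 : 0 < s by lra.
have := block_le (s^-1%:C *: xb) b xb erefl.
have -> : s^-1%:C *: xb + xb = (s^-1 + 1)%:C *: xb.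
  by rewrite rmorphD rmorph1 scalerDl scale1r.
rewrite -!snorm2 !snormZr -/s.
have q1 : snorm (tuple_form (hform H) n) b ^+ 2 <= 1.
  by rewrite expr_le1 ?snorm_ge0.
move: q1; have : 0 <= snorm (tuple_form (hform H) n) b ^+ 2 by apply: sqr_ge0.
move: (snorm _ b ^+ 2) => q q0 q1.
rewrite !ger0_norm ?addr_ge0 ?invr_ge0 ?(ltW s0)// mulVf ?gt_eqF//.
rewrite mulrDl mulVf ?gt_eqF// mul1r expr1n.
have N2 : N ^+ 2 < 1 + s by lra.
have : N ^+ 2 * (1 + q) < (1 + s) ^+ 2 + q; last by lra.
apply: (@lt_le_trans _ _ ((1 + s) * (1 + q))); first by rewrite ltr_pM2r//; lra.
have : 0 <= s * (1 - q) by rewrite mulr_ge0 ?(ltW s0)// subr_ge0.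
by have := sqr_ge0 s; rewrite sqrrD; lra.
Qed.

End Forward.

(** * The compression to the kernel of 1 - v* v in an ultrapower *)

Section Backward.
Variables (R : realType) (X : operatorSpace R) (v : X).
Hypothesis v1 : `|v| <= 1.
Variables (K : hilbertSpace R) (T : X -> {linear K -> K}).
Hypothesis TP : complete_isometry (@mnorm R X) T.
Local Notation w := (hform K).
Local Notation act x := (opfun (map_mx T x)).

Lemma v_contraction a : w (T v a) (T v a) <= w a a.
Proof.
have := act_le TP (v%:M : 'M[X]_1) (fun=> a) isT.
have : mnorm (v%:M : 'M[X]_1) <= 1 by rewrite -lecR -mnorm1E.
move=> m1; rewrite /snorm !tuple_formE !big_ord1 (act_scalar TP) => h.
rewrite -ler_sqrt ?rform_ge0//; apply: le_trans h _.
by rewrite -[leRHS]mul1r ler_wpM2r// sqrtr_ge0.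
Qed.

Let d a b := w a b - w (T v a) (T v b).

Let dDl a b c : d (a + b) c = d a c + d b c.
Proof. by rewrite /d linearD !rformDl; ring. Qed.
Let dZl (t : R) a b : d (t%:C *: a) b = t * d a b.
Proof. by rewrite /d linearZ !rformZl; ring. Qed.
Let dI a b : d ('i%C *: a) ('i%C *: b) = d a b.
Proof. by rewrite /d !linearZ !rformI. Qed.
Let dC a b : d a b = d b a.
Proof. by rewrite /d rformC (rformC w (T v a)). Qed.
Let d_ge0 a : 0 <= d a a.
Proof. by rewrite subr_ge0 v_contraction. Qed.

(** The form of 1 - v* v. *)
Definition defect : semi_inner K := SemiInner dDl dZl dI dC d_ge0.

Lemma defectE a b : w (T v a) (T v b) = w a b - defect a b.
Proof. by rewrite /= /d subKr. Qed.

Lemma defect_le a : defect a a <= w a a.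
Proof. by rewrite /= /d lerBlDr lerDl rform_ge0. Qed.

Lemma rep_form x : exists B : bounded_form w,
  forall a b, B a b = w (T x a) (T v b).
Proof.
have [k kP] : exists k : R, forall h, snorm w (T x h) <= k * snorm w h.
  by apply/bounded_opP; case: TP.
have Ble a b : `|w (T x a) (T v b)| <= k * snorm w a * snorm w b.
  apply: le_trans (cauchy_schwarz_abs _ _ _) _.
  by apply: ler_pM; rewrite ?snorm_ge0// ler_wsqrtr// v_contraction.
have Dl a b c : w (T x (a + b)) (T v c) = w (T x a) (T v c) + w (T x b) (T v c).
  by rewrite linearD rformDl.
have Dr a b c : w (T x a) (T v (b + c)) = w (T x a) (T v b) + w (T x a) (T v c).
  by rewrite linearD rformDr.
have Zl (t : R) a b : w (T x (t%:C *: a)) (T v b) = t * w (T x a) (T v b).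
  by rewrite linearZ rformZl.
have Zr (t : R) a b : w (T x a) (T v (t%:C *: b)) = t * w (T x a) (T v b).
  by rewrite linearZ rformZr.
have I a b : w (T x ('i%C *: a)) (T v ('i%C *: b)) = w (T x a) (T v b).
  by rewrite !linearZ rformI.
by exists (BoundedForm Dl Dr Zl Zr I Ble).
Qed.

Local Notation tnorm n := (snorm (tuple_form w n)).

Lemma defect_tuple n (a : 'I_n -> K) :
  tuple_form w n (fun i => T v (a i)) (fun i => T v (a i)) =
  tuple_form w n a a - tuple_form defect n a a.
Proof.
rewrite !tuple_formE -sumrB; apply: eq_bigr => i _; exact: defectE.
Qed.

(** The estimate that drives the converse.  Let xi and eta be the components of
a vector of norm at most 1 at which the block operator of t x / |x| has squared
norm at least 1 + t - t^2.  Its three quadratic terms add up to at most 1 + t^2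
minus the defects of xi and eta, and the cross term is at most t, so the defects
are at most 2 t^2 and the cross term is at least t - 2 t^2. *)
Lemma near_extremal (delta : R) n (x : 'M[X]_n) (e : R) :
  (forall y : 'M[X]_n, mnorm y < delta ->
     Num.sqrt (1 + mnorm y) <= mnorm (block_mx v%:M y 0 v%:M)) ->
  0 < delta -> (0 < n)%N -> 0 < mnorm x -> 0 < e ->
  exists ab : ('I_n -> K) * ('I_n -> K),
  [/\ tuple_form w n ab.1 ab.1 + tuple_form w n ab.2 ab.2 <= 1,
      tuple_form defect n ab.1 ab.1 <= e,
      tuple_form defect n ab.2 ab.2 <= e &
      mnorm x / 2 - e <= tuple_form w n (act x ab.2) (fun i => T v (ab.1 i))].
Proof.
move=> hd d0 n0; set t0 := mnorm x => t00 e0.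
have [t [tpos td t2 te tt]] :
    exists t, [/\ 0 < t, t < delta, t <= 2^-1, t <= e & t0 * t <= e].
  (* With t <= 1/2 the defects are at most 2 t^2 <= t <= e. *)
  exists (Num.min (Num.min (delta / 2) 2^-1) (Num.min e (e / t0))).
  have hd2 : delta / 2 < delta by lra.
  split; rewrite ?lt_min ?ge_min ?gt_min ?lexx ?hd2 ?orbT//.
    by rewrite !divr_gt0// invr_gt0 e0 ltr0n.
  by rewrite mulrC -ler_pdivlMr// !ge_min lexx !orbT.
pose s := t / t0; have s0 : 0 < s by rewrite divr_gt0.
pose y : 'M[X]_n := map_mx (fun z => s%:C *: z) x.
have yt : mnorm y = t by rewrite (mnorm_scale TP)// divfK// gt_eqF.
have nn0 : (0 < n + n)%N by rewrite addn_gt0 n0.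
have c_lt : Num.sqrt (1 + t - t ^+ 2) < mnorm (block_mx v%:M y 0 v%:M).
  apply: lt_le_trans (hd y _); rewrite yt//.
  by rewrite ltr_sqrt ?ltrBlDr ?ltrDl ?exprn_gt0// addr_gt0.
have [a a1] := act_near TP nn0 c_lt.
rewrite -ltr_sqr ?nnegrE ?sqrtr_ge0 ?snorm_ge0// snorm2 (act_block_form TP).
have tsq : t ^+ 2 <= t / 2 by rewrite expr2 ler_pM2l.
rewrite sqr_sqrtr; last by lra.
have {a1} : tuple_form w _ a a <= 1 by rewrite -snorm2 expr_le1 ?snorm_ge0.
rewrite tuple_form_split.
set xi := fun i => a (lshift n i); set eta := fun i => a (rshift n i) => q1.
set vxi := fun i => T v (xi i).
have -> : (fun i => T v (a (lshift n i)) + act y eta i) = vxi + act y eta by [].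
rewrite !expand_rform (rformC _ (act y eta)) defect_tuple.
have yeta : act y eta = s%:C *: act x eta by rewrite (act_scale TP).
have ynorm : tnorm n (act y eta) <= t * tnorm n eta by rewrite -yt act_le.
have vnorm : tnorm n vxi <= tnorm n xi.
  by rewrite ler_wsqrtr// defect_tuple lerBlDr lerDl rform_ge0.
have r_le := cauchy_schwarz (tuple_form w n) vxi (act y eta).
have r_le2 : tnorm n vxi * tnorm n (act y eta) <= tnorm n xi * (t * tnorm n eta).
  by rewrite ler_pM ?snorm_ge0.
have y_le : tuple_form w n (act y eta) (act y eta) <= t ^+ 2 * tuple_form w n eta eta.
  by rewrite -!snorm2 -exprMn ler_sqr ?nnegrE ?mulr_ge0 ?snorm_ge0// ltW.
have xe : t * (2 * (tnorm n xi * tnorm n eta)) <= t * 1.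
  rewrite ler_pM2l//; apply: le_trans q1; rewrite -!snorm2.
  by have := sqr_ge0 (tnorm n xi - tnorm n eta); rewrite sqrrB; lra.
have y_le1 : t ^+ 2 * tuple_form w n eta eta <= t ^+ 2 * 1.
  by rewrite ler_pM2l ?exprn_gt0//; have := rform_ge0 (tuple_form w n) xi; lra.
have dxi := rform_ge0 (tuple_form defect n) xi.
have deta := rform_ge0 (tuple_form defect n) eta.
rewrite {1}/vxi defect_tuple => key.
have r2 : 2 * tuple_form w n vxi (act y eta) <= t by lra.
have dxi_le : tuple_form defect n xi xi <= e by lra.
have deta_le : tuple_form defect n eta eta <= e by lra.
exists (xi, eta); split; [exact: q1|exact: dxi_le|exact: deta_le|].
change (t0 / 2 - e <= tuple_form w n (act x eta) vxi).
have : t / 2 - t ^+ 2 <= tuple_form w n vxi (act y eta) by lra.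
rewrite yeta rformZr rformC -ler_pdivrMl// => h; apply: le_trans h.
have -> : s^-1 * (t / 2 - t ^+ 2) = t0 / 2 - t0 * t.
  by rewrite /s; field; rewrite !gt_eqF.
by rewrite lerD2l lerN2.
Qed.

Section Compression.
Variable U : set_system nat.
Hypotheses (UU : UltraFilter U) (Ufree : \oo `<=` U).
Local Notation V := (ultra_kernel U w defect).

Variables (H : hilbertSpace R) (p : V -> H).
Hypotheses (p_linear : linear p) (p_surj : forall h, exists a, h = p a).
Hypothesis p_inner : forall a b,
  @inner R H (p a) (p b) = cform (ultra_form UU w defect) a b.

(** The operator phi(x), given by <phi(x) a, b> = lim <x a_k, v b_k>. *)
Lemma compression x : exists S : {linear H -> H}, bounded_op S /\
  forall a b : V, (fun k => w (T x (a k)) (T v (b k))) @ U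
    --> hform H (S (p a)) (p b).
Proof.
have [B BE] := rep_form x.
have uc := @ultra_complete _ _ UU Ufree _ w defect defect_le.
have [S [Sb SE]] := operator_of_form uc p_linear p_surj p_inner
  (ultra_bounded_form UU defect B).
exists S; split=> // a b; rewrite SE.
have := @lim_form_cvg _ _ UU _ w defect B a b.
by rewrite (_ : (fun k => B (a k) (b k)) = (fun k => w (T x (a k)) (T v (b k))))//;
  apply/funext => k; rewrite BE.
Qed.

Definition compress x : {linear H -> H} := sval (cid (compression x)).

Lemma compress_bounded x : bounded_op (compress x).
Proof. by rewrite /compress; case: cid => S /= []. Qed.

Lemma compress_cvg x (a b : V) :
  (fun k => w (T x (a k)) (T v (b k))) @ U --> hform H (compress x (p a)) (p b).
Proof. by rewrite /compress; case: cid => S /= []. Qed.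

Arguments compress_cvg : clear implicits.

(** <v a_k, v b_k> differs from <a_k, b_k> by the defect form, which tends to
zero on the kernel by the Cauchy-Schwarz inequality. *)
Lemma compress_unit h : compress v h = h.
Proof.
apply: (hform_ext p_surj) => b; have [a ->] := p_surj h.
apply: (limit_unique _ (compress_cvg v a b)).
rewrite (hform_proj p_inner).
under eq_fun do rewrite defectE.
rewrite -[ultra_form _ _ _ a b]subr0; apply: cvgB; first exact: ultra_form_cvg.
apply/norm_cvg0P.
apply: (@null_le _ _ UU _ (fun k => snorm defect (a k) * snorm defect (b k))).
  by move=> k; rewrite normr_ge0 cauchy_schwarz_abs.
by rewrite -(mulr0 (0 : R)); apply: cvgM; apply: ultra_null.
Qed.

Lemma compress_linear : linear (fun x => compress x : H -> H).
Proof.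
move=> z x y; apply/funext => h; apply: (hform_ext p_surj) => b.
have [a ->] := p_surj h.
have -> : ((z *: (compress x : H -> H)) + compress y) (p a)
  = compress x (z *: p a) + compress y (p a) by rewrite linearZ.
have -> : z *: p a = p (z *: a).
  have p0 : p 0 = 0.
    by have := p_linear (-1) 0 0; rewrite !scaleN1r !addNr.
  by have := p_linear z a 0; rewrite p0 !addr0.
rewrite rformDl; apply: (limit_unique _ (compress_cvg _ a b)).
apply: (limit_ext _ (cvgD (compress_cvg x (z *: a) b) (compress_cvg y a b))) => k.
rewrite (repD TP) (repZ TP) rformDl; congr (_ + _).
by rewrite ultraZ linearZ.
Qed.

Section Amplification.
Variable n : nat.
Local Notation tnorm G := (snorm (tuple_form (hform G) n)).
Let coords (a : 'I_n -> V) k : 'I_n -> K := fun i => a i k.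

Lemma tnorm_cvg (a : 'I_n -> V) :
  (fun k => tnorm K (coords a k)) @ U --> tnorm H (p \o a).
Proof.
apply: (continuous_cvg _ (@sqrt_continuous R _)).
rewrite tuple_formE; under eq_fun do rewrite tuple_formE.
apply: cvg_big => [|i _]; first exact: add_continuous.
by rewrite [hform H _ _](hform_proj p_inner (a i) (a i)); apply: ultra_form_cvg.
Qed.

Lemma pairing_cvg (x : 'M[X]_n) (a b : 'I_n -> V) :
  (fun k => tuple_form w n (act x (coords a k)) (fun i => T v (coords b k i))) @ U -->
  tuple_form (hform H) n (opfun (map_mx compress x) (p \o a)) (p \o b).
Proof.
rewrite tuple_formE; under eq_fun do rewrite tuple_formE.
apply: cvg_big => [|i _]; first exact: add_continuous.
rewrite /opfun rform_suml.
under eq_fun do rewrite rform_suml.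
apply: cvg_big => [|j _]; first exact: add_continuous.
rewrite [map_mx compress x i j]mxE.
by apply: (limit_ext _ (compress_cvg (x i j) (a j) (b i))) => k; rewrite mxE.
Qed.

Arguments tnorm_cvg : clear implicits.
Arguments pairing_cvg : clear implicits.

Lemma v_tuple_contraction (a : 'I_n -> K) : tnorm K (fun i => T v (a i)) <= tnorm K a.
Proof.
rewrite ler_wsqrtr// !tuple_formE; apply: ler_sum => i _; exact: v_contraction.
Qed.

(** With g = phi(x) h represented by the sequences b, |g|^2 is the limit of
<x a_k, v b_k>, which is at most |x| |a_k| |b_k|. *)
Lemma compress_contraction (x : 'M[X]_n) : (0 < n)%N ->
  opmx_norm (map_mx compress x) <= mnorm x.
Proof.
move=> n0; have m0 := mnorm_ge0 TP x n0; apply: opmx_norm_le => // h.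
have /choice[a ha] := fun i => p_surj (h i).
set g := opfun _ h; have /choice[b gb] := fun i => p_surj (g i).
have hE : h = p \o a by apply/funext => i; rewrite /= ha.
have gE : g = p \o b by apply/funext => i; rewrite /= gb.
have gg : tnorm H g ^+ 2 <= mnorm x * tnorm H h * tnorm H g.
  have -> : tnorm H g ^+ 2 = tuple_form (hform H) n
      (opfun (map_mx compress x) (p \o a)) (p \o b) by rewrite snorm2 -hE -gE.
  rewrite gE [in tnorm H h]hE.
  apply: (ler_cvg_to (pairing_cvg x a b)
    (cvgM (cvgM (cvg_cst (mnorm x)) (tnorm_cvg a)) (tnorm_cvg b))).
  apply: nearW => k; apply: le_trans (cauchy_schwarz _ _ _) _.
  by apply: ler_pM; rewrite ?snorm_ge0 ?act_le ?v_tuple_contraction.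
have [->|g0] := eqVneq (tnorm H g) 0; first by rewrite mulr_ge0 ?snorm_ge0.
by move: gg; rewrite expr2 ler_pM2r// lt_def g0 snorm_ge0.
Qed.

(** The nearly extremal vectors for the errors 1 / (k + 1)^2 are the terms of
sequences of the kernel, and their classes pair through phi(x) to at least
|x| / 2; the square makes the seminorms of the defects at most 1 / (k + 1). *)
Lemma compress_expansion (delta : R) (x : 'M[X]_n) :
  (forall y : 'M[X]_n, mnorm y < delta ->
     Num.sqrt (1 + mnorm y) <= mnorm (block_mx v%:M y 0 v%:M)) ->
  0 < delta -> (0 < n)%N -> mnorm x <= opmx_norm (map_mx compress x).
Proof.
move=> hd d0 n0; have cb i j : bounded_op (map_mx compress x i j).
  by rewrite mxE; apply: compress_bounded.
have [x0|x0] := leP (mnorm x) 0; first exact: le_trans x0 (opmx_norm_ge0 cb).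
have h0 k : 0 < harmonic k :> R by rewrite invr_gt0.
have /choice[ab abP] k := near_extremal hd d0 n0 x0 (exprn_gt0 2 (h0 k)).
have harmonic_cvg : @harmonic R @ U --> (0 : R).
  by move=> A /cvg_harmonic; apply: Ufree.
have mem (c : nat -> 'I_n -> K) : (forall k, tuple_form w n (c k) (c k) <= 1) ->
    (forall k, tuple_form defect n (c k) (c k) <= harmonic k ^+ 2) ->
    forall i, ultra_mem U w defect (fun k => c k i).
  move=> c1 c2 i; apply/asboolP; split.
    exists 1 => k; apply: le_trans (snorm_tuple _ _ _) _.
    by rewrite -(sqrtr1 R) ler_wsqrtr.
  apply: (@null_le _ _ UU _ (@harmonic R)) => // k; rewrite snorm_ge0 andTb.
  apply: le_trans (snorm_tuple _ _ _) _.
  by rewrite -(ger0_norm (ltW (h0 k))) -sqrtr_sqr ler_wsqrtr.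
have mem1 : forall i, ultra_mem U w defect (fun k => (ab k).1 i).
  apply: mem => k; have [q1 d1 d2 _] := abP k => //.
  by have := rform_ge0 (tuple_form w n) (ab k).2; lra.
have mem2 : forall i, ultra_mem U w defect (fun k => (ab k).2 i).
  apply: mem => k; have [q1 d1 d2 _] := abP k => //.
  by have := rform_ge0 (tuple_form w n) (ab k).1; lra.
pose b i := UltraKernel (mem1 i); pose a i := UltraKernel (mem2 i).
have q1 : tnorm H (p \o b) ^+ 2 + tnorm H (p \o a) ^+ 2 <= 1.
  apply: (cvgr_to_le (cvgD (cvgM (tnorm_cvg b) (tnorm_cvg b))
                           (cvgM (tnorm_cvg a) (tnorm_cvg a)))).
  apply: nearW => k; have [+ _ _ _] := abP k.
  by rewrite -!snorm2.
have pair : mnorm x / 2 <=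
    tuple_form (hform H) n (opfun (map_mx compress x) (p \o a)) (p \o b).
  rewrite -[leLHS]subr0.
  apply: (ler_cvg_to (cvgB (cvg_cst (mnorm x / 2)) harmonic_cvg) (pairing_cvg x a b)).
  apply: nearW => k; have [_ _ _] := abP k; apply: le_trans.
  rewrite lerD2l lerN2 -[leRHS]mulr1 expr2 ler_pM2l//.
  by rewrite invf_le1// ler1n.
have := le_trans pair (cauchy_schwarz _ _ _).
have := opfun_le cb (p \o a); have N0 := opmx_norm_ge0 cb.
move: q1; have := snorm_ge0 (tuple_form (hform H) n) (p \o a).
have := snorm_ge0 (tuple_form (hform H) n) (p \o b).
move: (tnorm H (opfun (map_mx compress x) (p \o a))) (tnorm H (p \o a))
  (tnorm H (p \o b)) => L A B B0 A0 q1 LA mB.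
have : L * B <= opmx_norm (map_mx compress x) * A * B by rewrite ler_wpM2r.
have : opmx_norm (map_mx compress x) * (A * B) <= opmx_norm (map_mx compress x) * 2^-1.
  by apply: ler_wpM2l => //; have := sqr_ge0 (A - B); rewrite sqrrB; lra.
by rewrite mulrA; lra.
Qed.

End Amplification.
End Compression.

(** The space of the compression is nonzero: otherwise v would vanish, and the
inequality for x = 0 would read 1 <= 0. *)
Lemma unital_of_block_bound (delta : R) : 0 < delta ->
  (forall n (x : 'M[X]_n), (0 < n)%N -> mnorm x < delta ->
     Num.sqrt (1 + mnorm x) <= mnorm (block_mx v%:M x 0 v%:M)) ->
  unital_operator_space v.
Proof.
move=> d0 hd; have [U [UU Ufree]] := ultraFilterLemma (@eventually_filter).
have uc := @ultra_complete _ _ UU Ufree _ w defect defect_le.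
have [H [p [pl ps pi]]] := hilbert_of_semi_inner uc.
pose S := compress Ufree pl ps pi.
have S_isom : complete_isometry (@mnorm R X) S.
  split; [exact: compress_linear|exact: compress_bounded|].
  move=> n x n0; apply/eqP; rewrite eq_le compress_contraction//=.
  exact: (compress_expansion Ufree pl ps pi x (fun y => hd n y n0) d0 n0).
exists H, S; split=> //; last exact: compress_unit.
apply: contrapT => H0.
have v0 a : T v a = 0.
  have m0 : mnorm (v%:M : 'M[X]_1) <= 0.
    apply: (mnorm_le S_isom) => // a'; rewrite mul0r le_eqVlt; apply/orP; left.
    rewrite (_ : opfun _ _ = 0) ?snorm0//; apply/funext => i.
    by apply/eqP; apply: contrapT => /negP h; apply: H0; eexists; exact: h.
  have := act_le TP (v%:M : 'M[X]_1) (fun=> a) isT.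
  move=> h; apply/hnorm0_eq0/eqP; rewrite eq_le snorm_ge0 andbT.
  have := snorm_tuple w (opfun (map_mx T (v%:M : 'M[X]_1)) (fun=> a)) 0.
  rewrite (act_scalar TP) => /le_trans; apply; apply: le_trans h _.
  by rewrite mulr_le0_ge0// snorm_ge0.
have m0 : mnorm (0 : 'M[X]_1) = 0.
  apply/eqP; rewrite eq_le (mnorm_ge0 TP)// andbT; apply: (mnorm_le TP) => // a.
  rewrite mul0r (_ : opfun _ _ = 0) ?snorm0//; apply/funext => i.
  by rewrite (actE T); apply: big1 => j _; rewrite mxE (rep0 TP).
have := hd 1%N 0 isT; rewrite m0 addr0 sqrtr1 => /(_ d0); apply/negP; rewrite -ltNge.
apply: le_lt_trans (ltr01); apply: (mnorm_le TP) => // a.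
rewrite mul0r -(sqrtr0 R) ler_wsqrtr// (act_block_form TP) /= !big_ord1 !v0.
by rewrite (actE T) big_ord1 mxE (rep0 TP) addr0 linear0l addr0.
Qed.

End Backward.

Theorem theorem3p1 (R : realType) (X : operatorSpace R) (v : X)
    (hv : `|v| <= 1) :
  unital_operator_space v <->
  exists delta : R, 0 < delta /\
    forall (n : nat) (x : 'M[X]_n), (0 < n)%N -> mnorm x < delta ->
      Num.sqrt (1 + mnorm x) <= mnorm (block_mx v%:M x 0 v%:M).
Proof.
split=> [v_unital|[delta [delta0 hdelta]]].
  exists 1; split=> // n x n0 _.
  have [K [T TP]] := mnorm_repr X.
  have N0 := mnorm_ge0 TP (block_mx v%:M x 0 v%:M) (ltn_addr n n0).
  rewrite -(ger0_norm N0) -sqrtr_sqr ler_wsqrtr//.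
  exact: unital_block_norm.
have [K [T TP]] := mnorm_repr X.
exact: (unital_of_block_bound hv TP delta0 hdelta).
Qed.
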